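(* Let $G_1$ and $G_2$ be finite graphs. Then $\mathcal{B}(G_1)\cong\mathcal{B}(G_2)$ if and only if $G_1'\cong G_2'$, where $G_i'$ is the graph obtained from $G_i$ by removing all universal vertices.
   Context: All graphs are finite and simple. A vertex of $G$ is universal if it has degree $|V(G)|-1$. An independent set partition of $G$ is a partition of $V(G)$ into nonempty independent sets (parts). For such a partition $P$ and $v\in V(G)$, let $P-v$ be the partition of $V(G)\setminus\{v\}$ obtained by deleting $v$ from its part (discarding that part if it becomes empty). The Bell colouring graph $\mathcal{B}(G)$ has as vertices the independent set partitions of $G$, with $P\neq Q$ adjacent iff $P-v=Q-v$ for some $v\in V(G)$. *)

(* Defs.v *)
From mathcomp Require Import all_boot.

Set Implicit Arguments.
Unset Strict Implicit.
Unset Printing Implicit Defensive.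

Record sgraph := SGraph {
  vertex :> finType;
  adj : rel vertex;
  adj_sym : symmetric adj;
  adj_irrefl : irreflexive adj
}.

Definition isomorphic (G H : sgraph) : Prop :=
  exists f : G -> H, bijective f /\ {mono f : x y / adj x y}.

Definition degree (G : sgraph) (v : G) : nat := #|[set w | adj v w]|.

Definition universal (G : sgraph) (v : G) : bool := degree v == #|G|.-1.

Section Induced.
Variables (G : sgraph) (p : pred G).

Definition induced_adj : rel {v : G | p v} := fun x y => adj (val x) (val y).

Fact induced_adj_sym : symmetric induced_adj.
Proof. by move=> x y; apply: adj_sym. Qed.

Fact induced_adj_irrefl : irreflexive induced_adj.
Proof. by move=> x; apply: adj_irrefl. Qed.

Definition induced : sgraph := SGraph induced_adj_sym induced_adj_irrefl.

End Induced.

Definition remove_universal (G : sgraph) : sgraph :=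
  induced (fun v : G => ~~ universal v).

Definition independent (G : sgraph) (A : {set G}) : bool :=
  [forall x in A, forall y in A, ~~ adj x y].

(* Nonemptiness of the parts is included in [partition]. *)
Definition indep_partition (G : sgraph) (P : {set {set G}}) : bool :=
  partition P [set: G] && [forall A in P, independent A].

Definition delete_vertex (G : sgraph) (P : {set {set G}}) (v : G) :
    {set {set G}} :=
  [set A :\ v | A in P] :\ set0.

Section BellGraph.
Variable G : sgraph.

Definition bell_adj : rel {P : {set {set G}} | indep_partition P} :=
  fun P Q => (P != Q) &&
    [exists v : G, delete_vertex (val P) v == delete_vertex (val Q) v].

Fact bell_adj_sym : symmetric bell_adj.
Proof.
move=> P Q; rewrite /bell_adj eq_sym; congr (_ && _).
by apply: eq_existsb => v; rewrite eq_sym.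
Qed.

Fact bell_adj_irrefl : irreflexive bell_adj.
Proof. by move=> P; rewrite /bell_adj eqxx. Qed.

Definition bell_graph : sgraph := SGraph bell_adj_sym bell_adj_irrefl.

End BellGraph.

(* Main.v *)
Require Import Defs.
From mathcomp Require Import all_boot.

(* Let H be the complement of G, so that the parts of a partition are cliques
   of H, and let S be the partition into singletons. The neighbours of S in
   B(G) are the edges of H, two of them being adjacent iff the edges meet; and
   three pairwise adjacent ones have a common neighbour other than S and not
   adjacent to S iff they form a triangle rather than a claw. A line graph in
   which triangles are told apart from claws determines the stars of the
   vertices, hence H up to isolated vertices, which are the universal vertices
   of G.

   It remains to find S. Any two nonadjacent neighbours Q, Q' of S have exactly
   one common neighbour X at distance 2 from S, and Q, Q' are the only common
   neighbours of X and S. If P has this property, then a part A of P with at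
   least two elements is either an isolated triangle of H, or an edge whose
   other neighbours in H are leaves. In both cases the involution of B(G) which
   exchanges the partitions having A as a part with those in which A is split
   into singletons, and fixes the others, is an automorphism. Composing with
   such automorphisms turns an isomorphism of Bell graphs into one preserving
   S. *)

Set Implicit Arguments.
Unset Strict Implicit.
Unset Printing Implicit Defensive.

(** * Independent set partitions as equivalence relations *)

Section Partitions.
Variable G : sgraph.
Local Notation B := (bell_graph G).
Implicit Types (P Q X : B) (x y z u v : G) (A : {set G}).

Definition together P x y : bool := pblock (val P) x == pblock (val P) y.

Lemma bell_partition P : partition (val P) [set: G].
Proof. by have /andP[] := valP P. Qed.

Lemma together_mem P x y : together P x y = (y \in pblock (val P) x).
Proof.
have /and3P[/eqP cP tP _] := bell_partition P.
by rewrite /together eq_pblock // cP inE.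
Qed.

Lemma together_refl P x : together P x x.
Proof. exact: eqxx. Qed.

Lemma together_sym P x y : together P x y = together P y x.
Proof. exact: eq_sym. Qed.

Lemma together_trans P x y z :
  together P x y -> together P y z -> together P x z.
Proof. by move=> /eqP xy /eqP yz; apply/eqP; rewrite xy. Qed.

Lemma together_nadj P x y : together P x y -> ~~ adj x y.
Proof.
rewrite together_mem => yx; have /andP[/and3P[/eqP cP _ _]] := valP P.
have xP: x \in cover (val P) by rewrite cP inE.
move=> /forall_inP/(_ _ (pblock_mem xP))/forall_inP iP.
by apply: (forall_inP (iP x _)); rewrite ?mem_pblock.
Qed.

Lemma together_ext P Q : together P =2 together Q -> P = Q.
Proof.
move=> PQ; apply: val_inj.
rewrite -(equivalence_partition_pblock (bell_partition P)).
rewrite -(equivalence_partition_pblock (bell_partition Q)).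
apply: eq_imset => x; apply/setP=> y; rewrite !inE /=.
by rewrite -!together_mem PQ.
Qed.

Lemma colouring_partition (T : eqType) (f : G -> T) :
  (forall x y, adj x y -> f x != f y) ->
  indep_partition (preim_partition f [set: G]).
Proof.
move=> fP; rewrite /indep_partition preim_partitionP /=.
apply/forall_inP=> A /imsetP[x _ ->].
apply/forall_inP=> y /[!inE] /eqP xy; apply/forall_inP=> z /[!inE] /eqP xz.
by apply/negP=> /fP; rewrite -xy -xz eqxx.
Qed.

(** Partitions are built below as the fibres of a proper colouring with colours in any type, so that
    [together] reduces to equality of colours. *)
Definition of_colouring (T : eqType) (f : G -> T)
    (fP : forall x y, adj x y -> f x != f y) : B :=
  exist _ (preim_partition f [set: G]) (colouring_partition fP).

Lemma together_colouring (T : eqType) (f : G -> T) fP x y :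
  together (@of_colouring T f fP) x y = (f x == f y).
Proof.
rewrite together_mem /= pblock_equivalence_partition ?inE //.
by split=> // /eqP ->.
Qed.

(** The relational form of P - v = Q - v, as [delete_vertex_near] shows; it avoids sets of sets. *)
Definition near v P Q :=
  forall x y, x != v -> y != v -> together P x y = together Q x y.

Lemma near_sym v P Q : near v P Q -> near v Q P.
Proof. by move=> n x y xv yv; rewrite n. Qed.

Lemma mem_delete_vertex P v (D : {set G}) :
  reflect (exists2 x, x != v & D = [set y | (y != v) && together P x y])
          (D \in delete_vertex (val P) v).
Proof.
have /and3P[/eqP cP tP n0] := bell_partition P.
apply: (iffP setD1P) => [[D0 /imsetP[A AP DA]]|[x xv ->]].
  have /set0Pn[x] := D0; rewrite DA !inE => /andP[xv xA]; exists x => //.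
  by apply/setP=> y; rewrite !inE together_mem (def_pblock tP AP xA).
split; first by apply/set0Pn; exists x; rewrite inE xv together_refl.
apply/imsetP; exists (pblock (val P) x).
  by apply: pblock_mem; rewrite cP inE.
by apply/setP=> y; rewrite !inE together_mem.
Qed.

Lemma delete_vertex_near P Q v :
  reflect (near v P Q) (delete_vertex (val P) v == delete_vertex (val Q) v).
Proof.
apply: (iffP eqP) => [PQ x y xv yv|].
  have: [set z | (z != v) && together P x z] \in delete_vertex (val P) v.
    by apply/mem_delete_vertex; exists x.
  rewrite PQ => /mem_delete_vertex[z zv /setP E].
  have := E y; have := E x; rewrite !inE xv yv together_refl /=.
  by move=> /esym/eqP zx ->; rewrite /together zx.
move=> n; apply/setP=> D; apply/mem_delete_vertex/mem_delete_vertex.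
  case=> x xv ->; exists x => //; apply/setP=> y; rewrite !inE.
  by case yv: (y != v); rewrite //= n.
case=> x xv ->; exists x => //; apply/setP=> y; rewrite !inE.
by case yv: (y != v); rewrite //= n.
Qed.

Lemma bell_adjP P Q : reflect (P <> Q /\ exists v, near v P Q) (adj P Q).
Proof.
apply: (iffP andP) => -[/eqP PQ]; last first.
  by case=> v n; split=> //; apply/existsP; exists v; apply/delete_vertex_near.
by case/existsP=> v /delete_vertex_near n; split=> //; exists v.
Qed.

(** A clique of the complement H; the case [x = y] is harmless by irreflexivity. *)
Definition clique A := forall x y, x \in A -> y \in A -> ~~ adj x y.

Lemma carve_subproof P A : clique A -> forall x y, adj x y ->
  (if x \in A then None else Some (pblock (val P) x)) !=
  (if y \in A then None else Some (pblock (val P) y)).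
Proof.
move=> cA x y xy; case: ifP => xA; case: ifP => yA //.
  by have := cA _ _ xA yA; rewrite xy.
by apply: contraTneq xy => -[]/eqP; apply: together_nadj.
Qed.

(** The colour [None] makes [A] one part, and the other parts lose their elements in [A]. *)
Definition carve P A (cA : clique A) : B := of_colouring (carve_subproof P cA).

Lemma carveE P A (cA : clique A) x y : together (carve P cA) x y =
  if x \in A then y \in A else (y \notin A) && together P x y.
Proof. by rewrite together_colouring; case: ifP => xA; case: ifP. Qed.

Lemma dissolve_subproof P A x y : adj x y ->
  (if x \in A then inl x else inr (pblock (val P) x)) !=
  (if y \in A then inl y else inr (pblock (val P) y)) :> G + {set G}.
Proof.
move=> xy; case: ifP => xA; case: ifP => yA //.
  by apply: contraTneq xy => -[->]; rewrite adj_irrefl.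
by apply: contraTneq xy => -[]/eqP; apply: together_nadj.
Qed.

Definition dissolve P A : B := of_colouring (dissolve_subproof P A).

Lemma dissolveE P A x y : together (dissolve P A) x y =
  if (x \in A) || (y \in A) then x == y else together P x y.
Proof.
rewrite together_colouring; case: ifP => xA; case: ifP => yA //=.
all: by apply/esym/eqP=> xy; rewrite -xy xA in yA.
Qed.

Lemma discrete_subproof x y : adj x y -> x != y.
Proof. by apply: contraTneq => ->; rewrite adj_irrefl. Qed.

Definition discrete : B := of_colouring discrete_subproof.

Lemma discreteE x y : together discrete x y = (x == y).
Proof. exact: together_colouring. Qed.

End Partitions.

(** * Distance two in the Bell graph, and adjacency in the complement *)

Definition far (B : sgraph) (P X : B) : Prop := X <> P /\ ~~ adj P X.

(** The property of S from the overview. It speaks of adjacency only, so isomorphisms preserve it.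
    As X is adjacent to Q, [far P X] means distance exactly 2. *)
Definition good (B : sgraph) (P : B) : Prop := forall Q Q' : B,
  adj P Q -> adj P Q' -> far Q Q' -> exists X : B,
  [/\ far P X /\ (adj Q X /\ adj Q' X),
      forall Y, far P Y -> adj Q Y -> adj Q' Y -> Y = X &
      forall R, adj P R -> adj X R -> R = Q \/ R = Q'].

Section FarAndNear.
Variable G : sgraph.
Local Notation B := (bell_graph G).
Implicit Types (P Q X : B) (x y z u v w : G) (A : {set G}).

Definition coadj x y : bool := (x != y) && ~~ adj x y.

Lemma coadj_sym x y : coadj x y = coadj y x.
Proof. by rewrite /coadj eq_sym adj_sym. Qed.

Lemma coadj_neq x y : coadj x y -> x != y. Proof. by case/andP. Qed.

Lemma together_coadj P x y : x != y -> together P x y -> coadj x y.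
Proof. by move=> xy /together_nadj nxy; rewrite /coadj xy. Qed.

Lemma clique2 x y : coadj x y -> clique [set x; y].
Proof.
move=> /andP[_ xy] a b; rewrite !inE.
by case/orP=> /eqP-> /orP[]/eqP->; rewrite ?adj_irrefl // adj_sym.
Qed.

Lemma clique3 x y z : coadj x y -> coadj y z -> coadj x z ->
  clique [set x; y; z].
Proof.
move=> /andP[_ xy] /andP[_ yz] /andP[_ xz] a b; rewrite !inE.
by case/orP=> [/orP[]|] /eqP-> /orP[/orP[]|] /eqP->;
  rewrite ?adj_irrefl // adj_sym.
Qed.

Lemma farP P X : far P X <-> X <> P /\ forall v, ~ near v P X.
Proof.
split=> -[ne nP]; split=> //.
  move=> v n; case/negP: nP; apply/bell_adjP; split; last by exists v.
  by move=> E; apply: ne.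
by apply/bell_adjP=> -[_ [v n]]; apply: (nP v).
Qed.

Lemma near_adj v P Q x y : near v P Q -> together P x y <> together Q x y ->
  adj P Q.
Proof.
move=> n ne; apply/bell_adjP; split; last by exists v.
by move=> E; apply: ne; rewrite E.
Qed.

(** Deleting a single vertex cannot remove both disagreements, because the two pairs are
    disjoint. *)
Lemma far_cross P X a b c d :
  [/\ a != c, a != d, b != c & b != d] ->
  together P a b <> together X a b -> together P c d <> together X c d ->
  far P X.
Proof.
move=> [ac ad bc bd] ab cd; apply/farP; split; first by move=> E; rewrite E in ab.
move=> v n; apply: ab; apply: (n); apply: contra_notN cd => /eqP E.
  by apply: n; rewrite -E eq_sym.
by apply: n; rewrite -E eq_sym.
Qed.

End FarAndNear.

(** * Automation for explicitly modified partitions *)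

Ltac neq_side := solve [assumption | rewrite eq_sym; assumption].

Ltac apart H x y := first
  [ rewrite (H y); [|neq_side ..]
  | rewrite [together _ x y]together_sym (H x); [|neq_side ..] ].

(** Hypotheses [forall b, b != _ -> _] record that a part has no elements beyond those listed;
    [apart] applies them to either argument of [together]. *)
Ltac simp_together := repeat first
  [ progress rewrite ?carveE ?dissolveE ?inE ?eqxx ?together_refl
      ?andbT ?orbT ?andbF ?orbF ?andbb ?orbb /=
  | match goal with
    | H : is_true (?x != ?y) |- context [?x == ?y] => rewrite (negbTE H)
    | H : is_true (?x != ?y) |- context [?y == ?x] =>
        rewrite [y == x]eq_sym (negbTE H)
    | H : is_true (together ?P ?x ?y) |- context [together ?P ?x ?y] => rewrite H
    | H : is_true (together ?P ?x ?y) |- context [together ?P ?y ?x] =>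
        rewrite [together P y x]together_sym H
    | H : is_true (~~ together ?P ?x ?y) |- context [together ?P ?x ?y] =>
        rewrite (negbTE H)
    | H : is_true (~~ together ?P ?x ?y) |- context [together ?P ?y ?x] =>
        rewrite [together P y x]together_sym (negbTE H)
    | H : forall b, is_true (b != _) -> _ |- context [together ?P ?x ?y] =>
        apart H x y
    end ].

(** A modified partition differs from the old one only at a few named vertices, so both arguments
    are compared with each of these. *)
Ltac near_cases := let x := fresh "x" in let y := fresh "y" in
  intros x y ? ?; simp_together;
  repeat (match goal with
          | |- context [x == ?b] => case: (eqVneq x b) => [?|?]; [subst x|]
          | |- context [y == ?b] => case: (eqVneq y b) => [?|?]; [subst y|]
          | |- context [?b == x] => case: (eqVneq x b) => [?|?]; [subst x|]
          | |- context [?b == y] => case: (eqVneq y b) => [?|?]; [subst y|]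
          end; simp_together); try done.

(** * Shape of the nontrivial parts of a good partition *)

Section GoodPartitions.
Variable G : sgraph.
Local Notation B := (bell_graph G).
Implicit Types (P Q X : B) (x y z u v w : G) (A : {set G}).

(* After splitting off u and z, two choices of X arise: u and z may be left
   single or joined to each other. *)
Lemma good_nonsingle_edge P u a z b : good P -> coadj u z ->
  together P u a -> together P z b ->
  u != a -> z != b -> u != b -> z != a -> a != b -> False.
Proof.
move=> gP uz ua zb nua nzb nub nza nab; have nuz := coadj_neq uz.
have Pu : adj P (dissolve P [set u]).
  by apply: (@near_adj _ u _ _ u a); [near_cases|simp_together].
have Pz : adj P (dissolve P [set z]).
  by apply: (@near_adj _ z _ _ z b); [near_cases|simp_together].
have [|X [_ uX _]] := gP _ _ Pu Pz.
  by apply: (@far_cross _ _ _ u a z b); [split; rewrite // eq_sym|simp_together|simp_together].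
have X1 : dissolve P [set u; z] = X.
  apply: uX.
  - by apply: (@far_cross _ _ _ u a z b); [split; rewrite // eq_sym|simp_together|simp_together].
  - by apply: (@near_adj _ z _ _ z b); [near_cases|simp_together].
  - by apply: (@near_adj _ u _ _ u a); [near_cases|simp_together].
have X2 : carve P (clique2 uz) = X.
  apply: uX.
  - by apply: (@far_cross _ _ _ u a z b); [split; rewrite // eq_sym|simp_together|simp_together].
  - by apply: (@near_adj _ z _ _ z u); [near_cases|simp_together].
  - by apply: (@near_adj _ u _ _ u z); [near_cases|simp_together].
have := congr1 (fun Y => together Y u z) X1.
by rewrite -X2; simp_together.
Qed.


(** In a part with four elements, [u] and [v] can be split off singly or jointly, with [w] and [z]
    left behind as witnesses for [good_nonsingle_edge]. *)
Lemma good_card_part P u v w z : good P -> together P u v -> together P u w ->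
  u != v -> u != w -> v != w -> z != u -> z != v -> z != w ->
  together P u z = false.
Proof.
move=> gP uv uw nuv nuw nvw nzu nzv nzw; apply/negP=> uz.
have vz : together P v z by apply: together_trans uz; rewrite together_sym.
by apply: (good_nonsingle_edge gP (together_coadj nuv uv) uw vz); neq_side.
Qed.

(** Otherwise the edge uz of H would join two different nontrivial parts, against
    [good_nonsingle_edge]. So an outside neighbour of a nontrivial part is a singleton part. *)
Lemma good_edge_out P u v z b : good P -> together P u v -> u != v ->
  ~~ together P u z -> coadj u z -> b != z -> together P z b = false.
Proof.
move=> gP uv nuv nuz uz zb; apply/negP=> tzb.
have ub : ~~ together P u b.
  by apply: contra nuz => ub; apply: together_trans ub _; rewrite together_sym.
apply: (good_nonsingle_edge gP uz uv tzb nuv); first by rewrite eq_sym.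
- by apply: contraNneq ub => ->; rewrite together_refl.
- by apply: contraNneq nuz => ->.
- by apply: contraNneq ub => <-.
Qed.

(* Joining u to z and splitting off v determine X = uz | v | w, which is also
   adjacent to the partition splitting off w. *)
Lemma good_part3 P u v w z : good P -> together P u v -> together P u w ->
  u != v -> u != w -> v != w -> ~~ together P u z -> ~~ coadj u z.
Proof.
move=> gP uv uw nuv nuw nvw nuz; apply/negP=> uz.
have z1 b : b != z -> together P z b = false.
  exact: (good_edge_out gP uv nuv nuz uz).
have nzu := coadj_neq uz.
have nzv : z != v by apply: contraNneq nuz => ->.
have nzw : z != w by apply: contraNneq nuz => ->.
have vw : together P v w by apply: together_trans uw; rewrite together_sym.
have u1 b : b != u -> b != v -> b != w -> together P u b = false.
  exact: (good_card_part gP uv uw).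
have v1 b : b != u -> b != v -> b != w -> together P v b = false.
  by move=> bu bv bw; apply: (@good_card_part _ v u w); rewrite // 1?together_sym // eq_sym.
have w1 b : b != u -> b != v -> b != w -> together P w b = false.
  by move=> bu bv bw; apply: (@good_card_part _ w u v); rewrite // 1?together_sym // eq_sym.
have PQ : adj P (carve P (clique2 uz)).
  by apply: (@near_adj _ u _ _ u z); [near_cases|simp_together].
have Pv : adj P (dissolve P [set v]).
  by apply: (@near_adj _ v _ _ v w); [near_cases|simp_together].
have Pw : adj P (dissolve P [set w]).
  by apply: (@near_adj _ w _ _ w v); [near_cases|simp_together].
have [|X [_ uX cX]] := gP _ _ PQ Pv.
  by apply: (@far_cross _ _ _ u z v w); [split; neq_side|simp_together|simp_together].
have XE : dissolve (carve P (clique2 uz)) [set v] = X.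
  apply: uX.
  - by apply: (@far_cross _ _ _ u z v w); [split; neq_side|simp_together|simp_together].
  - by apply: (@near_adj _ v _ _ v w); [near_cases|simp_together].
  - by apply: (@near_adj _ u _ _ u z); [near_cases|simp_together].
case: (cX _ Pw).
- by rewrite -XE; apply: (@near_adj _ u _ _ u z); [near_cases|simp_together].
- by move/(congr1 (fun Y => together Y u z)); simp_together.
- by move/(congr1 (fun Y => together Y w u)); simp_together.
Qed.

(* No X exists for Q = u | v | z and Q' = uvz. *)
Lemma good_part2_triangle P u v z : good P -> together P u v -> u != v ->
  ~~ together P u z -> coadj u z -> ~~ coadj v z.
Proof.
move=> gP uv nuv nuz uz; apply/negP=> vz.
have z1 b : b != z -> together P z b = false.
  exact: (good_edge_out gP uv nuv nuz uz).
have nzu := coadj_neq uz; have nzv := coadj_neq vz.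
have A1 w : w != u -> w != v -> together P u w = false.
  move=> wu wv; apply/negP=> uw; apply/negP: uz.
  by apply: (good_part3 gP uv uw nuv); rewrite // eq_sym.
have A2 w : w != u -> w != v -> together P v w = false.
  move=> wu wv; apply/negP=> vw; have /negP[] := negbT (A1 _ wu wv).
  exact: together_trans uv vw.
have cA := clique3 (together_coadj nuv uv) vz uz.
have Pu : adj P (dissolve P [set u]).
  by apply: (@near_adj _ u _ _ u v); [near_cases|simp_together].
have PA : adj P (carve P cA).
  by apply: (@near_adj _ z _ _ u z); [near_cases|simp_together].
have [|X [[/farP[_ fX] [aX aX']] _ _]] := gP _ _ Pu PA.
  apply/farP; split; first by move/(congr1 (fun Y => together Y u v)); simp_together.
  move=> p n; have [pu|pu] := eqVneq p u.
    by have := n v z; simp_together; subst; simp_together => /(_ isT isT).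
  have [pv|pv] := eqVneq p v.
    by have := n u z; simp_together; subst; simp_together => /(_ isT isT).
  by have := n u v; simp_together => /(_ isT isT).
(* Here [p] and [q] are the vertices moved from Q and Q' to reach X. Off [u], and also off [v], Q
   agrees with P, and off [z] so does Q'; a move there would bring X next to P. *)
have /bell_adjP[_ [p np]] := aX; have /bell_adjP[_ [q nq]] := aX'.
have pu : p != u.
  apply/eqP=> E; apply: (fX u) => a b au bu; rewrite -np ?E //.
  by move: a b au bu; near_cases.
have pv : p != v.
  apply/eqP=> E; apply: (fX v) => a b au bu; rewrite -np ?E //.
  by move: a b au bu; near_cases.
have qz : q != z.
  apply/eqP=> E; apply: (fX z) => a b au bu; rewrite -nq ?E //.
  by move: a b au bu; near_cases.
have Xuv : together X u v = false.
  by rewrite -np 1?eq_sym //; simp_together.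
(* If [q = a], then X keeps [b] and [z] together, which forces [p = z]; then X differs from P only
   in the place of [b], against its distance from P. *)
have H a b : (a = u /\ b = v) \/ (a = v /\ b = u) -> q != a.
  move=> ab; apply/eqP=> E.
  have Xbz : together X b z by rewrite -nq; case: ab => -[? ?]; subst; simp_together.
  have Xab : together X a b = false.
    by case: ab => -[-> ->]; rewrite // together_sym.
  have pz : p = z.
    apply/eqP; apply: contraTT Xbz => pz; rewrite -np.
    - by case: ab => -[? ?]; subst; simp_together.
    - by case: ab => -[? ?]; subst; neq_side.
    - by rewrite eq_sym.
  have Xaz : together X a z = false.
    by apply: contraFF Xab => az; apply: together_trans az _; rewrite together_sym.
  have Xz y : y != b -> together P z y = together X z y.
    move=> yb; have [->|ya] := eqVneq y a.
      by rewrite [RHS]together_sym Xaz z1 //; case: ab => -[-> _]; neq_side.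
    have [->|yz] := eqVneq y z; first by rewrite !together_refl.
    rewrite -nq; first by rewrite z1 //; case: ab => -[? ?]; subst; simp_together.
    - by rewrite E; case: ab => -[-> _]; neq_side.
    - by rewrite E.
  apply: (fX b) => c d cb db.
  have [->|cz] := eqVneq c z; first exact: Xz.
  have [->|dz] := eqVneq d z; first by rewrite together_sym Xz // together_sym.
  rewrite -np ?pz //; move: c d cb db cz dz.
  by case: ab => -[? ?]; subst; near_cases.
have := H u v; have := H v u => /(_ (or_intror (conj erefl erefl))) qv.
move=> /(_ (or_introl (conj erefl erefl))) qu.
by have := nq u v; rewrite Xuv; simp_together => /(_ isT isT).
Qed.

(* Let Q join u to z and Q' join x to z. If x is single then X = xz | u | v, which
   is also adjacent to the partition splitting u from v; otherwise no X exists,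
   since u and x cannot be joined. *)
Lemma good_part2_leaf P u v z x : good P -> together P u v -> u != v ->
  ~~ together P u z -> coadj u z -> x != u -> ~~ coadj z x.
Proof.
move=> gP uv nuv nuz uz xu; have [->|xv] := eqVneq x v.
  by rewrite coadj_sym; apply: good_part2_triangle gP uv nuv nuz uz.
apply/negP=> zx.
have z1 b : b != z -> together P z b = false.
  exact: (good_edge_out gP uv nuv nuz uz).
have nzu := coadj_neq uz; have nzx := coadj_neq zx.
have nzv : z != v by apply: contraNneq nuz => ->.
have A1 w : w != u -> w != v -> together P u w = false.
  move=> wu wv; apply/negP=> uw; apply/negP: uz.
  by apply: (good_part3 gP uv uw nuv); rewrite // eq_sym.
have A2 w : w != u -> w != v -> together P v w = false.
  move=> wu wv; apply/negP=> vw; have /negP[] := negbT (A1 _ wu wv).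
  exact: together_trans uv vw.
have Pu : adj P (carve P (clique2 uz)).
  by apply: (@near_adj _ u _ _ u z); [near_cases|simp_together].
have Px : adj P (carve P (clique2 zx)).
  by apply: (@near_adj _ x _ _ x z); [near_cases|simp_together].
have Pv : adj P (dissolve P [set u]).
  by apply: (@near_adj _ u _ _ u v); [near_cases|simp_together].
have [|X [[/farP[_ fX] [aX aX']] uX cX]] := gP _ _ Pu Px.
  by apply: (@far_cross _ _ _ u v x z); [split; neq_side|simp_together|simp_together].
have [c /andP[cx xc]|x1'] := pickP (fun c => (c != x) && together P x c); last first.
  have x1 b : b != x -> together P x b = false.
    by move=> bx; have := x1' b; rewrite bx.
  have XE : dissolve (carve P (clique2 zx)) [set u] = X.
    apply: uX.
    - by apply: (@far_cross _ _ _ u v x z); [split; neq_side|simp_together|simp_together].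
    - by apply: (@near_adj _ z _ _ z u); [near_cases|simp_together].
    - by apply: (@near_adj _ u _ _ u v); [near_cases|simp_together].
  case: (cX _ Pv).
  - by rewrite -XE; apply: (@near_adj _ x _ _ z x); [near_cases|simp_together].
  - by move/(congr1 (fun Y => together Y u z)); simp_together.
  - by move/(congr1 (fun Y => together Y u v)); simp_together.
have cz : c != z by apply: contraTneq xc => ->; rewrite together_sym z1 // eq_sym.
have cu : c != u by apply: contraTneq xc => ->; rewrite together_sym A1.
have cv : c != v by apply: contraTneq xc => ->; rewrite together_sym A2.
have nux : ~~ coadj u x.
  by apply/negP=> ux; apply: (good_nonsingle_edge gP ux uv xc); neq_side.
have /bell_adjP[_ [p np]] := aX; have /bell_adjP[_ [q nq]] := aX'.
have pu : p != u.
  apply/eqP=> E; apply: (fX u) => a b au bu; rewrite -np ?E //.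
  by move: a b au bu; near_cases.
have qx : q != x.
  apply/eqP=> E; apply: (fX x) => a b au bu; rewrite -nq ?E //.
  by move: a b au bu; near_cases.
have [pv|pv] := eqVneq p v.
  have Xuz : together X u z by rewrite -np ?pv //; simp_together.
  have Xxz : together X x z = false by rewrite -np ?pv //; simp_together.
  have Xxc : together X x c by rewrite -np ?pv //; simp_together.
  have qz : q = z.
    apply/eqP; apply: contraFT Xxz => qz; rewrite -nq; simp_together => //; neq_side.
  by move: Xxc; rewrite -nq ?qz; simp_together => //; neq_side.
(* From here [q] turns out to be [u] or [v], and [p] to be [x]; then [u], [z] and [x] share a part
   of X, against [nux]. *)
have Xuv : together X u v = false by rewrite -np 1?eq_sym //; simp_together.
have quv : q \in [:: u; v].
  apply: contraFT Xuv; rewrite !inE negb_or => /andP[qu qv].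
  by rewrite -nq; simp_together.
have [qz qc] : q != z /\ q != c.
  by split; move: quv; rewrite !inE => /orP[]/eqP->; neq_side.
have Xxz : together X x z by rewrite -nq 1?eq_sym //; simp_together.
have Xxc : together X x c = false by rewrite -nq 1?eq_sym //; simp_together.
have px : p = x.
  apply/eqP; apply: contraTT Xxz => px.
  have [pz|pz] := eqVneq p z; last by rewrite -np 1?eq_sym //; simp_together.
  by move: Xxc; rewrite -np ?pz; simp_together.
have Xuz : together X u z by rewrite -np ?px //; simp_together.
case/negP: nux; apply: (@together_coadj _ X); first by rewrite eq_sym.
by apply: together_trans Xuz _; rewrite together_sym.
Qed.

End GoodPartitions.

(** * The automorphism that merges and splits a special clique *)

Section Toggle.
Variables (G : sgraph) (A : {set G}).
Local Notation B := (bell_graph G).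
Implicit Types (P Q : B) (x y z : G).

Definition is_part Q : bool :=
  [forall x in A, forall y, together Q x y == (y \in A)].

Definition all_single Q : bool :=
  [forall x in A, forall y, together Q x y == (x == y)].

Lemma is_partP Q :
  reflect (forall x y, x \in A -> together Q x y = (y \in A)) (is_part Q).
Proof.
apply: (iffP forall_inP) => [H x y /H /forallP/(_ y)/eqP //|H x xA].
by apply/forallP=> y; rewrite H.
Qed.

Lemma all_singleP Q :
  reflect (forall x y, x \in A -> together Q x y = (x == y)) (all_single Q).
Proof.
apply: (iffP forall_inP) => [H x y /H /forallP/(_ y)/eqP //|H x xA].
by apply/forallP=> y; rewrite H.
Qed.

Lemma near_on v P Q :
  (forall x y, x != v -> y != v -> x \in A -> together P x y = together Q x y) ->
  (forall x y, x != v -> y != v -> x \notin A -> y \notin A ->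
     together P x y = together Q x y) ->
  near v P Q.
Proof.
move=> on off x y xv yv; have [xA|xA] := boolP (x \in A); first exact: on.
have [yA|yA] := boolP (y \in A); last exact: off.
by rewrite together_sym on // together_sym.
Qed.

Lemma uniq_card (s : seq G) : uniq s -> all [in A] s -> size s <= #|A|.
Proof.
move=> /card_uniqP <- /allP sA; apply: subset_leq_card.
by apply/subsetP=> x; apply: sA.
Qed.

Hypotheses (cA : clique A) (A_gt1 : 1 < #|A|) (A_le3 : #|A| <= 3).
(** With the bounds on its size, this makes [A] an isolated triangle of H, or an edge whose outside
    neighbours are leaves. *)
Hypothesis leafA : forall x z, x \in A -> z \notin A -> coadj x z ->
  #|A| = 2 /\ forall y, coadj z y -> y = x.

Definition toggle Q : B :=
  if is_part Q then dissolve Q A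
  else if all_single Q then carve Q cA else Q.

Lemma other x : exists2 y, y \in A & y != x.
Proof.
have : 0 < #|A :\ x|.
  by move: A_gt1; rewrite (cardsD1 x); case: (x \in A) => //= /ltnW.
by case/card_gt0P=> y; rewrite !inE => /andP[]; exists y.
Qed.

Lemma part_not_single Q : is_part Q -> ~~ all_single Q.
Proof.
have /card_gt0P[x xA] := ltnW A_gt1; have [y yA yx] := other x.
move=> /is_partP p; apply/negP=> /all_singleP s.
by have := p x y xA; rewrite s // yA eq_sym (negbTE yx).
Qed.

Lemma toggleK : involutive toggle.
Proof.
move=> Q; rewrite {2}/toggle; case: ifP => [p|np].
  have s : all_single (dissolve Q A).
    by apply/all_singleP=> x y xA; rewrite dissolveE xA.
  rewrite /toggle s ifN; last by apply: contraL s => /part_not_single.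
  apply: together_ext => x y; rewrite carveE dissolveE.
  have [xA|xA] := boolP (x \in A); first by rewrite (is_partP _ p).
  have [yA|yA] := boolP (y \in A) => //=.
  by rewrite together_sym (is_partP _ p) // (negbTE xA).
case: ifP => [s|ns]; last by rewrite /toggle np ns.
rewrite /toggle ifT; last by apply/is_partP=> x y xA; rewrite carveE xA.
apply: together_ext => x y; rewrite dissolveE carveE.
have [xA|xA] /= := boolP (x \in A); first by rewrite (all_singleP _ s).
have [yA|yA] //= := boolP (y \in A).
by rewrite together_sym (all_singleP _ s) // eq_sym.
Qed.

Lemma near_part_part z Q Q' : near z Q Q' ->
  near z (dissolve Q A) (dissolve Q' A).
Proof. by move=> n x y xz yz; rewrite !dissolveE n. Qed.

Lemma near_single_single z Q Q' : near z Q Q' ->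
  near z (carve Q cA) (carve Q' cA).
Proof. by move=> n x y xz yz; rewrite !carveE n. Qed.

(** Off [z] both descriptions of [A] hold at once, so exchanging them changes nothing there. *)
Lemma near_part_single z Q Q' : is_part Q -> all_single Q' -> near z Q Q' ->
  near z (dissolve Q A) (carve Q' cA).
Proof.
move=> /is_partP p /all_singleP s n; apply: near_on => x y xz yz xA.
  rewrite dissolveE carveE xA /=; case yA: (y \in A).
    by rewrite -s // -n // p.
  by apply/eqP=> E; rewrite -E xA in yA.
by move=> yA; rewrite dissolveE carveE (negbTE xA) yA /= (negbTE yA) n.
Qed.

Lemma mem_le2 z x y : #|A| = 2 -> z \in A -> x \in A -> y \in A ->
  x != z -> y != z -> x = y.
Proof.
move=> A2 zA xA yA xz yz; apply/eqP; apply/negPn/negP=> xy.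
have := @uniq_card [:: z; x; y]; rewrite /= !inE zA xA yA A2 xy.
by rewrite ![z == _]eq_sym (negbTE xz) (negbTE yz) => /(_ isT isT).
Qed.

Lemma mem_le3 z w x y : z \in A -> w \in A -> x \in A -> y \in A -> w != z ->
  x != z -> y != z -> x != w -> y != w -> x = y.
Proof.
move=> zA wA xA yA wz xz yz xw yw; apply/eqP; apply/negPn/negP=> xy.
have := @uniq_card [:: z; w; x; y]; rewrite /= !inE zA wA xA yA xy.
rewrite ![w == _]eq_sym ![z == _]eq_sym (negbTE xz) (negbTE yz) (negbTE wz).
by rewrite (negbTE xw) (negbTE yw) => /(_ isT isT); rewrite ltnNge A_le3.
Qed.

Lemma isolated_card3 x y Q : #|A| != 2 -> x \in A -> y \notin A ->
  together Q x y = false.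
Proof.
move=> A2 xA yA; apply/negP=> /together_coadj xy.
have /xy/(leafA xA yA)[A2' _] : x != y by apply: contraNneq yA => <-.
by rewrite A2' in A2.
Qed.

(** The moved vertex lies in [A]: an outside vertex could only have joined the whole of [A], but it
    has at most one neighbour there. *)
Lemma near_part_other z Q Q' : is_part Q -> ~~ is_part Q' -> near z Q Q' ->
  exists z', near z' (dissolve Q A) Q'.
Proof.
move=> /is_partP p np n; have [zA|zA] := boolP (z \in A); last first.
  case/negP: np; apply/is_partP=> x y xA.
  have nz a : a \in A -> a != z by apply: contraTneq => ->.
  have xz := nz _ xA.
  have [->|yz] := eqVneq y z; last by rewrite -n // p.
  rewrite (negbTE zA); apply/negP=> txz.
  have [x' x'A x'x] := other x.
  have x'z : together Q' x' z.
    by apply: together_trans txz; rewrite -n ?nz // p.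
  have [_ lf] := leafA xA zA (together_coadj xz txz).
  have /lf/eqP : coadj z x'.
    by apply: (@together_coadj _ Q'); rewrite 1?eq_sym ?nz // together_sym.
  by rewrite (negbTE x'x).
(* With two elements, deleting [z] leaves one vertex of [A], which is single on both sides. *)
have [A2|A2] := eqVneq #|A| 2.
  exists z; apply: near_on => x y xz yz xA; last first.
    by move=> yA; rewrite dissolveE (negbTE xA) (negbTE yA) n.
  rewrite dissolveE xA /= -n // p //; case yA: (y \in A).
    by apply/eqP/(mem_le2 A2 zA).
  by apply/eqP=> E; rewrite -E xA in yA.
have iso x y : x \in A -> y \notin A -> together Q' x y = false.
  exact: isolated_card3.
have z1 y : y != z -> together Q' z y = false.
  move=> yz; have [yA|] := boolP (y \in A); last exact: iso.
  apply: contraNF np => tzy; apply/is_partP=> a b aA.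
  have [bA|] := boolP (b \in A); last exact: iso.
  have zc c : c \in A -> together Q' z c.
    move=> cA'; have [->|cz] := eqVneq c z; first exact: together_refl.
    by apply: together_trans tzy _; rewrite -n // p.
  by apply: together_trans (zc _ bA); rewrite together_sym zc.
(* In an isolated triangle [z] is single in Q' and the other two stay together; deleting one of
   these, [w], leaves single vertices on both sides. *)
have [w wA wz] := other z; exists w; apply: near_on => x y xw yw xA; last first.
  move=> yA; rewrite dissolveE (negbTE xA) (negbTE yA) n //.
    by apply: contraNneq xA => ->.
  by apply: contraNneq yA => ->.
rewrite dissolveE xA /=; have [<-|xy] := eqVneq x y.
  by rewrite together_refl.
have [yA|yA] := boolP (y \in A); last by rewrite iso.
have [xz|xz] := eqVneq x z; first by rewrite xz z1 // -xz eq_sym.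
have [yz|yz] := eqVneq y z; first by rewrite together_sym yz z1.
by case/eqP: xy; apply: (mem_le3 zA wA).
Qed.

Lemma near_single_other z Q Q' : all_single Q -> ~~ all_single Q' ->
  near z Q Q' -> exists z', near z' (carve Q cA) Q'.
Proof.
move=> /all_singleP s ns n.
have [x [y [xA xy txy]]] : exists x y, [/\ x \in A, x != y & together Q' x y].
  move: ns; rewrite /all_single negb_forall_in => /existsP[x /andP[xA]].
  rewrite negb_forall => /existsP[y]; have [->|xy] := eqVneq x y.
    by rewrite together_refl.
  by move=> H; exists x, y; split=> //; move: H; case: together.
(* In an isolated triangle Q' joins [z] to some [w]. Once the third vertex [t] is deleted, zw is
   what remains of [A] on both sides. *)
have [A2|A2] := eqVneq #|A| 2; last first.
  have iso a b : a \in A -> b \notin A -> together Q' a b = false.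
    exact: isolated_card3.
  have yA : y \in A by apply: contraTT txy => yA; rewrite iso.
  have [w wA [zA wz tzw]] : exists2 w, w \in A & [/\ z \in A, w != z & together Q' z w].
    have [<-|xz] := eqVneq x z; first by exists y; rewrite // eq_sym.
    have [<-|yz] := eqVneq y z; first by exists x; rewrite // together_sym.
    by move: txy; rewrite -n // s // (negbTE xy).
  have [t tA /andP[tz tw]] : exists2 t, t \in A & (t != z) && (t != w).
    have : 0 < #|A :\ z :\ w|.
      move: A_gt1 A2; rewrite (cardsD1 z) (cardsD1 w (A :\ z)) !inE zA wA wz.
      by case: #|_|.
    by case/card_gt0P=> t; rewrite !inE => /and3P[tw tz tA]; exists t; rewrite ?tz.
  exists t; apply: near_on => a b at_ bt aA; last first.
    move=> bA; rewrite carveE (negbTE aA) bA n //.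
      by apply: contraNneq aA => ->.
    by apply: contraNneq bA => ->.
  rewrite carveE aA; have [bA|bA] := boolP (b \in A); last by rewrite iso.
  have zc c : c \in A -> c != t -> together Q' z c.
    move=> cA' ct; have [->|cz] := eqVneq c z; first exact: together_refl.
    have [->|cw] := eqVneq c w; first exact: tzw.
    by case/eqP: ct; apply: (mem_le3 zA wA).
  by apply/esym; apply: together_trans (zc _ bA bt); rewrite together_sym zc.
have [zA|zA] := boolP (z \in A).
  exists z; apply: near_on => a b az bz aA; last first.
    by move=> bA; rewrite carveE (negbTE aA) bA n.
  rewrite carveE aA -n // s //; case bA: (b \in A).
    by apply/esym/eqP/(mem_le2 A2 zA).
  by apply/esym/eqP=> E; rewrite -E aA in bA.
have nz a : a \in A -> a != z by apply: contraTneq => ->.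
(* An outside vertex [z] has joined [x] and is a leaf at [x]. Without [x] it is single in every
   partition, so [x] replaces [z] as the deleted vertex. *)
have yz : y = z.
  apply/eqP; apply: contraTT txy => yz.
  by rewrite -n ?(nz x) // s.
subst y; have [_ lf] := leafA xA zA (together_coadj xy txy).
have lfz R b : b != z -> b != x -> together R z b = false.
  move=> bz bx; apply: contraNF bx => tzb.
  by apply/eqP/lf/(together_coadj _ tzb); rewrite eq_sym.
exists x; apply: near_on => a b ax bx aA; last first.
  move=> bA; rewrite carveE (negbTE aA) bA /=.
  have [->|az] := eqVneq a z; have [->|bz] := eqVneq b z.
  - by rewrite !together_refl.
  - by rewrite !lfz.
  - by rewrite [LHS]together_sym [RHS]together_sym !lfz.
  - by rewrite n.
rewrite carveE aA; have [->|bz] := eqVneq b z.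
  by rewrite (negbTE zA) together_sym lfz ?nz.
rewrite -n ?(nz a) // s //; case bA: (b \in A).
  by apply/esym/eqP/(mem_le2 A2 xA).
by apply/esym/eqP=> E; rewrite -E aA in bA.
Qed.

Lemma toggle_near z Q Q' : near z Q Q' ->
  exists z', near z' (toggle Q) (toggle Q').
Proof.
move=> n; have n' := near_sym n; rewrite /toggle.
have sym R R' : (exists z', near z' R R') -> exists z', near z' R' R.
  by case=> z' m; exists z'; apply: near_sym.
have [p|np] := boolP (is_part Q); have [p'|np'] := boolP (is_part Q').
- by exists z; apply: near_part_part.
- case: ifPn => [s'|ns']; first by exists z; apply: near_part_single.
  exact: near_part_other n.
- case: ifPn => [s|ns].
    by exists z; apply/near_sym/near_part_single.
  by apply: sym; apply: near_part_other n'.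
- case: ifPn => [s|ns]; case: ifPn => [s'|ns'].
  + by exists z; apply: near_single_single.
  + exact: near_single_other n.
  + by apply: sym; apply: near_single_other n'.
  + by exists z.
Qed.

Lemma toggle_adj : {mono toggle : P Q / adj P Q}.
Proof.
have H P Q : adj P Q -> adj (toggle P) (toggle Q).
  move=> /bell_adjP[PQ [v /toggle_near[v' n]]]; apply/bell_adjP.
  by split; [move/(inv_inj toggleK)|exists v'].
by move=> P Q; apply/idP/idP=> /H //; rewrite !toggleK.
Qed.

End Toggle.

(** * The neighbours of S as edges of H, and goodness of S *)

Section Discrete.
Variable G : sgraph.
Local Notation B := (bell_graph G).
Local Notation S := (discrete G).
Implicit Types (P Q R X Y : B) (a b c d x y z : G).

Lemma adj_discrete_ex Q : adj S Q -> exists a b, a != b /\ together Q a b.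
Proof.
move=> /bell_adjP[SQ _].
have [/existsP[a /existsP[b /andP[ab t]]]|] :=
  boolP [exists a, exists b, (a != b) && together Q a b].
  by exists a, b.
rewrite negb_exists => /forallP H; case: SQ; apply: together_ext => x y.
rewrite discreteE; have [<-|xy] := eqVneq x y; first by rewrite together_refl.
have := H x; rewrite negb_exists => /forallP/(_ y).
by rewrite xy /=; case: together.
Qed.

(** Off the moved vertex all vertices are single. Hence that vertex is [a] or [b], and its part has
    no third element. *)
Lemma adj_discreteE Q a b : adj S Q -> a != b -> together Q a b ->
  forall x y, together Q x y =
    (x == y) || (x \in [set a; b]) && (y \in [set a; b]).
Proof.
move=> /bell_adjP[_ [v n]] ab Qab.
have vab : v \in [set a; b].
  apply: contraTT Qab; rewrite !inE negb_or ![v == _]eq_sym => /andP[va vb].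
  by rewrite -n // discreteE.
have H y : v != y -> together Q v y = (y \in [set a; b]).
  move=> vy; apply/idP/idP=> [Qvy|]; last first.
    move: vab vy; rewrite !inE => /orP[]/eqP-> E /orP[]/eqP yE; subst y.
    - by rewrite eqxx in E.
    - by [].
    - by rewrite together_sym.
    - by rewrite eqxx in E.
  move: vab; rewrite !inE => /orP[]/eqP E; subst v.
    have : together Q b y by apply: together_trans Qvy; rewrite together_sym.
    by rewrite -n; [|neq_side ..]; rewrite discreteE => /eqP->; rewrite eqxx orbT.
  have : together Q a y by apply: together_trans Qab _.
  by rewrite -n; [|neq_side ..]; rewrite discreteE => /eqP->; rewrite eqxx.
move=> x y; have [<-|xy] := eqVneq x y; first by rewrite together_refl.
have [E|xv] := eqVneq v x.
  by subst x; rewrite H // vab.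
have [E|yv] := eqVneq v y.
  by subst y; rewrite together_sym H 1?eq_sym // vab andbT.
rewrite -n; [|neq_side ..]; rewrite discreteE (negbTE xy) /=; apply/esym/negbTE.
move: vab xv yv; rewrite !inE => /orP[]/eqP-> /negbTE; rewrite [_ == x]eq_sym => -> /negbTE.
  by rewrite [_ == y]eq_sym => -> /=; apply: contraNN xy => /andP[/eqP-> /eqP->].
rewrite [_ == y]eq_sym => ->; rewrite !orbF.
by apply: contraNN xy => /andP[/eqP-> /eqP->].
Qed.

Lemma adj_discrete_eq Q R a b : adj S Q -> adj S R -> a != b ->
  together Q a b -> together R a b -> Q = R.
Proof.
move=> SQ SR ab Qab Rab; apply: together_ext => x y.
by rewrite (adj_discreteE SQ ab Qab) (adj_discreteE SR ab Rab).
Qed.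

Lemma discrete_edge a b : coadj a b -> exists2 Q, adj S Q & together Q a b.
Proof.
move=> ab; have nab := coadj_neq ab; exists (carve S (clique2 ab)); last by simp_together.
apply: (@near_adj _ a _ _ a b); last by rewrite discreteE; simp_together.
by move=> x y; rewrite discreteE; move: x y; near_cases; rewrite discreteE; simp_together.
Qed.

(** Off [a], or off [b], Q agrees with S, so a move at either end would bring X next to S. Thus X
    keeps the edge. *)
Lemma far_discrete_near Q X a b p : adj S Q -> a != b -> together Q a b ->
  far S X -> near p Q X -> [/\ p != a, p != b & together X a b].
Proof.
move=> SQ ab Qab /farP[_ fX] n; have Q2 := adj_discreteE SQ ab Qab.
have pa : p != a.
  apply/eqP=> E; apply: (fX p) => x y xp yp; rewrite -n // Q2 discreteE !inE.
  move: xp yp; rewrite E => /negbTE-> /negbTE-> /=.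
  by have [//|xy] := eqVneq x y; apply/esym/negbTE; apply: contraNN xy => /andP[/eqP-> /eqP->].
have pb : p != b.
  apply/eqP=> E; apply: (fX p) => x y xp yp; rewrite -n // Q2 discreteE !inE.
  move: xp yp; rewrite E => /negbTE-> /negbTE->; rewrite !orbF.
  by have [//|xy] := eqVneq x y; apply/esym/negbTE; apply: contraNN xy => /andP[/eqP-> /eqP->].
by split=> //; rewrite -n //; neq_side.
Qed.

Definition star a : {set B} :=
  [set Q | adj S Q && [exists b, (b != a) && together Q a b]].

Lemma starP a Q : reflect (adj S Q /\ exists2 b, a != b & together Q a b)
                          (Q \in star a).
Proof.
rewrite inE; apply: (iffP andP) => -[SQ].
  by case/existsP=> b /andP[ba t]; split=> //; exists b; rewrite // eq_sym.
by case=> b ab t; split=> //; apply/existsP; exists b; rewrite eq_sym ab.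
Qed.

Lemma star_edge Q a b : adj S Q -> a != b -> together Q a b ->
  (Q \in star a) /\ (Q \in star b).
Proof.
move=> SQ ab Qab; split; apply/starP; split=> //; first by exists b.
by exists a; rewrite 1?together_sym // eq_sym.
Qed.

Lemma star_together Q a b : a != b -> Q \in star a -> Q \in star b ->
  together Q a b.
Proof.
move=> ab /starP[SQ [c ac Qac]] /starP[_ [d bd Qbd]].
by move: Qbd; rewrite !(adj_discreteE SQ ac Qac) !inE eqxx (negbTE bd) /= => /andP[->]; rewrite orbT.
Qed.

Lemma star_near a Q R : Q \in star a -> R \in star a -> near a Q R.
Proof.
move=> /starP[SQ [c ac Qac]] /starP[SR [d ad Rad]] x y xa ya.
rewrite (adj_discreteE SQ ac Qac) (adj_discreteE SR ad Rad) !inE.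
rewrite (negbTE xa) (negbTE ya) /=; have [//|xy] /= := eqVneq x y.
have neq e : (x == e) && (y == e) = false.
  by apply: contraNF xy => /andP[/eqP-> /eqP->].
by rewrite !neq.
Qed.

Lemma star_adj a Q R : Q \in star a -> R \in star a -> Q <> R -> adj Q R.
Proof.
by move=> Qa Ra QR; apply/bell_adjP; split=> //; exists a; apply: star_near.
Qed.

(** The vertex moved between two edges is an end of both, so adjacent edges meet. *)
Lemma adj_star Q R a b : adj S Q -> adj S R -> adj Q R -> a != b ->
  together Q a b -> (R \in star a) \/ (R \in star b).
Proof.
move=> SQ SR /bell_adjP[_ [v n]] ab Qab.
have [c [d [cd Rcd]]] := adj_discrete_ex SR.
have E1 := adj_discreteE SQ ab Qab; have E2 := adj_discreteE SR cd Rcd.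
have [Rc Rd] := star_edge SR cd Rcd.
have [->|ac] := eqVneq a c; first by left.
have [->|ad] := eqVneq a d; first by left.
have [->|bc] := eqVneq b c; first by right.
have [->|bd] := eqVneq b d; first by right.
have [vab vcd] : v \in [:: a; b] /\ v \in [:: c; d].
  split; rewrite !inE -[_ || _]negbK negb_or ![v == _]eq_sym.
    apply/negP=> /andP[va vb]; have := n a b va vb; rewrite E1 E2; simp_together.
    by [].
  apply/negP=> /andP[vc vd]; have := n c d vc vd; rewrite E1 E2; simp_together => //.
move: vab vcd; rewrite !inE => /orP[]/eqP->; simp_together => //.
Qed.

Lemma far_edges Q R a b c d : adj S Q -> adj S R -> a != b -> c != d ->
  together Q a b -> together R c d -> far Q R ->
  [/\ a != c, a != d, b != c & b != d].
Proof.
move=> SQ SR ab cd Qab Rcd /farP[_ fQR].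
have [Qa Qb] := star_edge SQ ab Qab; have [Rc Rd] := star_edge SR cd Rcd.
by split; apply/eqP=> E; [rewrite E in Qa|rewrite E in Qa|rewrite E in Qb|rewrite E in Qb];
  (apply: (fQR c); exact: star_near) || (apply: (fQR d); exact: star_near).
Qed.

(** X keeps both edges. It is reached from Q by moving an end of cd and from R by moving an end of
    ab, so no other vertex is affected and the edges are not merged. *)
Lemma discrete_square_uniq Q R X a b c d :
  adj S Q -> adj S R -> a != b -> c != d ->
  together Q a b -> together R c d -> far Q R ->
  far S X -> adj Q X -> adj R X -> forall x y, together X x y =
  [|| x == y, (x \in [set a; b]) && (y \in [set a; b]) |
      (x \in [set c; d]) && (y \in [set c; d])].
Proof.
move=> SQ SR ab cd Qab Rcd fQR fX /bell_adjP[_ [p np]] /bell_adjP[_ [q nq]].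
have [ac ad bc bd] := far_edges SQ SR ab cd Qab Rcd fQR.
have [pa pb Xab] := far_discrete_near SQ ab Qab fX np.
have [qc qd Xcd] := far_discrete_near SR cd Rcd fX nq.
have E1 := adj_discreteE SQ ab Qab; have E2 := adj_discreteE SR cd Rcd.
(* The ends of the two edges are renamed so that the moved vertices are [a'] and [c']. *)
have main a' b' c' d' : [set a'; b'] = [set a; b] -> [set c'; d'] = [set c; d] ->
    [/\ a' != c', a' != d', b' != c' & b' != d'] -> a' != b' -> c' != d' ->
    together X a' b' -> together X c' d' -> q = a' -> p = c' ->
    forall x y, together X x y =
  [|| x == y, (x \in [set a; b]) && (y \in [set a; b]) |
      (x \in [set c; d]) && (y \in [set c; d])].
  move=> Eab Ecd [ac' ad' bc' bd'] ab' cd' Xab' Xcd' qE pE.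
  have E1' := E1; have E2' := E2; rewrite -Eab in E1'; rewrite -Ecd in E2'.
  rewrite -Eab -Ecd.
  have Xca : together X c' a' = false.
    apply/negP=> ca; have : together X d' b'.
      apply: together_trans (together_trans ca Xab').
      by rewrite together_sym.
    by rewrite -np ?pE; [|neq_side ..]; rewrite E1'; simp_together.
  have Xc y : y != c' -> together X c' y = (y == d').
    move=> yc; have [->//|yd] := eqVneq y d'.
    have [->//|ya] := eqVneq y a'.
    by rewrite -nq ?qE; [|neq_side ..]; rewrite E2'; simp_together.
  move=> x y; have [<-|xy] := eqVneq x y; first by rewrite together_refl.
  have [E|xc] := eqVneq x c'.
    subst x; rewrite Xc 1?eq_sym // !inE; simp_together.
    by rewrite eq_sym.
  have [E|yc] := eqVneq y c'.
    subst y; rewrite together_sym Xc // !inE; simp_together.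
    by rewrite ?orbF.
  rewrite -np ?pE // E1' !inE; simp_together.
  case: (eqVneq x d') => [?|]; case: (eqVneq y d') => [?|]; subst; simp_together => //.
  by rewrite eqxx in xy.
have [pE qE] : p \in [:: c; d] /\ q \in [:: a; b].
  split; rewrite !inE -[_ || _]negbK negb_or; apply/negP=> /andP[n1 n2].
    by have := Xcd; rewrite -np; [|neq_side ..]; rewrite E1; simp_together.
  by have := Xab; rewrite -nq; [|neq_side ..]; rewrite E2; simp_together.
move: pE qE; rewrite !inE.
have Xba : together X b a by rewrite together_sym.
have Xdc : together X d c by rewrite together_sym.
move=> /orP[]/eqP pE /orP[]/eqP qE.
- exact: (main a b c d).
- by apply: (main b a c d); rewrite // 1?setUC // eq_sym.
- by apply: (main a b d c); rewrite // 1?[LHS]setUC // eq_sym.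
- by apply: (main b a d c); rewrite // 1?[LHS]setUC // eq_sym.
Qed.

(** Nonadjacent neighbours of S are disjoint edges ab and cd, and X has exactly these as nontrivial
    parts. *)
Lemma discrete_good : good S.
Proof.
move=> Q R SQ SR fQR.
have [a [b [ab Qab]]] := adj_discrete_ex SQ.
have [c [d [cd Rcd]]] := adj_discrete_ex SR.
have [ac ad bc bd] := far_edges SQ SR ab cd Qab Rcd fQR.
have E1 := adj_discreteE SQ ab Qab; have E2 := adj_discreteE SR cd Rcd.
have X2 := discrete_square_uniq SQ SR ab cd Qab Rcd fQR.
have cdc := together_coadj cd Rcd; pose X := carve Q (clique2 cdc).
have fX : far S X.
  by apply: (@far_cross _ _ _ a b c d); rewrite // discreteE /X; simp_together.
have QX : adj Q X.
  apply: (@near_adj _ c _ _ c d); last by rewrite /X carveE !E1; simp_together.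
  rewrite /X => x y; rewrite carveE !E1 !inE; move: x y; near_cases.
have RX : adj R X.
  apply: (@near_adj _ a _ _ a b); last by rewrite /X carveE !E1 E2; simp_together.
  by rewrite /X => x y; rewrite carveE !E1 !E2 !inE; move: x y; near_cases.
exists X; split=> //.
  move=> Y fY QY RY; apply: together_ext => x y.
  by rewrite (X2 Y) // (X2 X).
move=> T ST /bell_adjP[_ [v n]].
have [Tab|Tab] := boolP (together T a b).
  by left; apply: adj_discrete_eq ab Tab Qab.
have [Tcd|Tcd] := boolP (together T c d).
  by right; apply: adj_discrete_eq cd Tcd Rcd.
have XE := X2 X fX QX RX.
(* If T contained neither edge, the vertex moved between X and T would lie on both. *)
have vab : v \in [:: a; b].
  rewrite !inE -[_ || _]negbK negb_or ![v == _]eq_sym; apply/negP=> /andP[va vb].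
  by case/negP: Tab; rewrite -n // XE !inE ?eqxx ?orbT.
have vcd : v \in [:: c; d].
  rewrite !inE -[_ || _]negbK negb_or ![v == _]eq_sym; apply/negP=> /andP[va vb].
  by case/negP: Tcd; rewrite -n // XE !inE ?eqxx ?orbT.
by move: vab vcd; rewrite !inE => /orP[]/eqP->; simp_together.
Qed.

End Discrete.

(** * Telling triangles from claws *)

Definition marked (B : sgraph) (P Q1 Q2 Q3 : B) : Prop :=
  exists X, far P X /\ [/\ adj Q1 X, adj Q2 X & adj Q3 X].

Section Marked.
Variable G : sgraph.
Local Notation B := (bell_graph G).
Local Notation S := (discrete G).
Implicit Types (P Q R X Y : B) (a b c d x y z : G).

(** The witness has abc as a part: moving out one vertex leaves the opposite edge, and no single
    deletion turns it into S. *)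
Lemma triangle_marked Q1 Q2 Q3 a b c : adj S Q1 -> adj S Q2 -> adj S Q3 ->
  a != b -> b != c -> a != c ->
  together Q1 a b -> together Q2 a c -> together Q3 b c -> marked S Q1 Q2 Q3.
Proof.
move=> SQ1 SQ2 SQ3 ab bc ac t1 t2 t3.
have E1 := adj_discreteE SQ1 ab t1; have E2 := adj_discreteE SQ2 ac t2.
have E3 := adj_discreteE SQ3 bc t3.
have cA := clique3 (together_coadj ab t1) (together_coadj bc t3)
  (together_coadj ac t2).
exists (carve S cA); split; last split.
- apply/farP; split.
    by move/(congr1 (fun Y => together Y a b)); rewrite discreteE; simp_together.
  move=> v n; have [va|va] := eqVneq v a.
    by have := n b c; rewrite discreteE va; simp_together => /(_ isT isT).
  have [vb|vb] := eqVneq v b.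
    by have := n a c; rewrite discreteE vb; simp_together => /(_ isT isT).
  by have := n a b; rewrite discreteE; simp_together => /(_ isT isT).
- apply: (@near_adj _ c _ _ a c); last by rewrite E1; simp_together.
  by move=> x y; rewrite E1 carveE discreteE; move: x y; near_cases.
- apply: (@near_adj _ b _ _ a b); last by rewrite E2; simp_together.
  by move=> x y; rewrite E2 carveE discreteE; move: x y; near_cases.
- apply: (@near_adj _ a _ _ a b); last by rewrite E3; simp_together.
  by move=> x y; rewrite E3 carveE discreteE; move: x y; near_cases.
Qed.

(** X would contain all three edges, hence [a], [b], [c] and [d] in one part, but only one vertex
    moves between the edge ab and X. *)
Lemma star_not_marked a Q1 Q2 Q3 : Q1 \in star a -> Q2 \in star a ->
  Q3 \in star a -> Q2 <> Q1 -> Q3 <> Q1 -> Q3 <> Q2 -> ~ marked S Q1 Q2 Q3.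
Proof.
move=> /starP[SQ1 [b ab t1]] /starP[SQ2 [c ac t2]] /starP[SQ3 [d ad t3]].
move=> n21 n31 n32 [X [fX [aX1 aX2 aX3]]].
have /bell_adjP[_ [p n]] := aX1.
have [pa pb _] := far_discrete_near SQ1 ab t1 fX n.
have /bell_adjP[_ [q /(far_discrete_near SQ2 ac t2 fX)[_ _ Xac]]] := aX2.
have /bell_adjP[_ [r /(far_discrete_near SQ3 ad t3 fX)[_ _ Xad]]] := aX3.
have cb : c != b by apply/eqP=> E; subst; apply: n21; apply: adj_discrete_eq ac t2 t1.
have db : d != b by apply/eqP=> E; subst; apply: n31; apply: adj_discrete_eq ad t3 t1.
have cd : c != d by apply/eqP=> E; subst; apply: n32; apply: adj_discrete_eq ad t3 t2.
have E1 := adj_discreteE SQ1 ab t1.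
have [pc|pc] := eqVneq p c.
  by move: Xad; rewrite -n ?pc; [|neq_side ..]; rewrite E1; simp_together.
by move: Xac; rewrite -n; [|neq_side ..]; rewrite E1; simp_together.
Qed.

(* Two edges at a determine the star of a: a third edge meeting both either
   passes through a or closes a triangle, and only triangles are marked. *)
Lemma star_char a Q0 Q1 Q : Q0 \in star a -> Q1 \in star a -> Q1 <> Q0 ->
  Q \in star a <-> Q = Q0 \/ Q = Q1 \/
    [/\ adj S Q, adj Q Q0, adj Q Q1 & ~ marked S Q0 Q1 Q].
Proof.
move=> Q0a Q1a n10; split=> [Qa|].
  have [->|/eqP nQ0] := eqVneq Q Q0; first by left.
  have [->|/eqP nQ1] := eqVneq Q Q1; first by right; left.
  right; right; split; try exact: star_adj Qa _ _.
    by case/starP: Qa.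
  exact: star_not_marked Qa _ _ _.
case=> [->//|[->//|[SQ a0 a1 nm]]].
have [Qa|Qa] := boolP (Q \in star a) => //; case: nm.
have /starP[SQ0 [b ab t0]] := Q0a; have /starP[SQ1 [c ac t1]] := Q1a.
have Qb : Q \in star b.
  by rewrite adj_sym in a0; case: (adj_star SQ0 SQ a0 ab t0); rewrite ?(negbTE Qa).
have Qc : Q \in star c.
  by rewrite adj_sym in a1; case: (adj_star SQ1 SQ a1 ac t1); rewrite ?(negbTE Qa).
have bc : b != c.
  by apply/eqP=> E; subst; apply: n10; apply: adj_discrete_eq ac t1 t0.
exact: triangle_marked SQ0 SQ1 SQ ab bc ac t0 t1 (star_together bc Qb Qc).
Qed.

Lemma star_nonempty a b : coadj a b -> exists Q, Q \in star a.
Proof.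
move=> ab; have [Q SQ t] := discrete_edge ab; exists Q.
by have [] := star_edge SQ (coadj_neq ab) t.
Qed.

End Marked.

(** * Invariance under isomorphism *)

Section Transport.
Variables (B C : sgraph) (f : B -> C) (g : C -> B).
Hypotheses (fK : cancel f g) (gK : cancel g f) (f_adj : {mono f : x y / adj x y}).

Lemma inv_adj : {mono g : x y / adj x y}.
Proof. by move=> x y; rewrite -f_adj !gK. Qed.

Lemma far_mono x y : far x y -> far (f x) (f y).
Proof. by case=> n na; split; [move/(can_inj fK)|rewrite f_adj]. Qed.

Lemma marked_mono x y z t : marked x y z t -> marked (f x) (f y) (f z) (f t).
Proof.
case=> X [fX [a1 a2 a3]]; exists (f X); split; first exact: far_mono.
by rewrite !f_adj.
Qed.

End Transport.

Lemma marked_iso (B C : sgraph) (f : B -> C) g x y z t :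
  cancel f g -> cancel g f -> {mono f : x y / adj x y} ->
  marked (f x) (f y) (f z) (f t) <-> marked x y z t.
Proof.
move=> fK gK fa; split; last exact: marked_mono.
by move/(marked_mono gK (inv_adj gK fa)); rewrite !fK.
Qed.

Lemma good_iso (B C : sgraph) (f : B -> C) g x :
  cancel f g -> cancel g f -> {mono f : x y / adj x y} -> good x -> good (f x).
Proof.
move=> fK gK fa gx Q R; have ga := inv_adj gK fa.
rewrite -(gK Q) -(gK R) !fa => xQ xR /(far_mono gK ga); rewrite !fK => fQR.
have [X [[fX [QX RX]] uX cX]] := gx _ _ xQ xR fQR.
exists (f X); split.
- by rewrite !fa; split=> //; apply: far_mono fX.
- move=> Y; rewrite -(gK Y) !fa => /(far_mono gK ga); rewrite !fK => fY QY RY.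
  by congr f; apply: uX.
- move=> T; rewrite -(gK T) !fa => xT XT.
  by case: (cX _ xT XT) => ->; [left|right].
Qed.

(** * Images of stars under an isomorphism preserving S *)

Section Stars.
Variables G1 G2 : sgraph.
Local Notation B1 := (bell_graph G1).
Local Notation B2 := (bell_graph G2).
Local Notation S1 := (discrete G1).
Local Notation S2 := (discrete G2).
Variables (f : B1 -> B2) (g : B2 -> B1).
Hypotheses (fK : cancel f g) (gK : cancel g f) (f_adj : {mono f : x y / adj x y}).
Hypothesis fS : f S1 = S2.
Implicit Types (a b : G1) (x y : G2).

Lemma adj_fS Q : adj S2 (f Q) = adj S1 Q.
Proof. by rewrite -fS f_adj. Qed.

Lemma preim_adj_star a b Q0 R : adj S1 Q0 -> a != b -> together Q0 a b ->
  adj S2 R -> adj (f Q0) R -> g R \in star a \/ g R \in star b.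
Proof.
move=> SQ ab t; rewrite -(gK R) adj_fS f_adj gK => SR QR.
exact: adj_star SQ SR QR ab t.
Qed.

(** Let xy be the image of the only edge ab at [a]. If further edges R1 and R2 left [x] and [y],
    their preimages would both pass through [b]. So R1 and R2 meet and close a triangle with xy,
    while the preimages form a claw. *)
Lemma star_single_image a Q0 : star a = [set Q0] ->
  exists x, star x = [set f Q0].
Proof.
move=> a1; have Q0a : Q0 \in star a by rewrite a1 inE.
have /starP[SQ0 [b ab t0]] := Q0a.
have SR0 : adj S2 (f Q0) by rewrite adj_fS.
have [x [y [xy u0]]] := adj_discrete_ex SR0.
have [R0x R0y] := star_edge SR0 xy u0.
have [E|] := eqVneq (star x) [set f Q0]; first by exists x.
have [E|] := eqVneq (star y) [set f Q0]; first by exists y.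
have ex z : f Q0 \in star z -> star z != [set f Q0] ->
    exists2 R, R \in star z & R <> f Q0.
  move=> Rz nz; have [/existsP[R /andP[Rz' /eqP nR]]|] :=
    boolP [exists R, (R \in star z) && (R != f Q0)]; first by exists R.
  rewrite negb_exists => /forallP H; case/eqP: nz; apply/setP=> R; rewrite inE.
  have [->//|nR] := eqVneq R (f Q0); apply/negbTE.
  by have := H R; rewrite nR andbT.
move=> /(ex _ R0y)[R2 R2y n20] /(ex _ R0x)[R1 R1x n10].
have SR1 : adj S2 R1 by case/starP: R1x.
have SR2 : adj S2 R2 by case/starP: R2y.
have n21 : R2 <> R1.
  move=> E; apply: n10; rewrite E in R2y.
  exact: adj_discrete_eq xy (star_together xy R1x R2y) u0.
have pre R z : f Q0 \in star z -> R \in star z -> R <> f Q0 -> g R \in star b.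
  move=> Qz Rz nR; have SR : adj S2 R by case/starP: Rz.
  have aR : adj (f Q0) R by apply: star_adj Qz Rz _ => E; apply: nR.
  case: (preim_adj_star SQ0 ab t0 SR aR) => //.
  by rewrite a1 inE => /eqP E; case: nR; rewrite -(gK R) E.
have Q1b := pre _ _ R0x R1x n10; have Q2b := pre _ _ R0y R2y n20.
have [_ Q0b] := star_edge SQ0 ab t0.
have a12 : adj R1 R2.
  rewrite -(gK R1) -(gK R2) f_adj; apply: star_adj Q1b Q2b _.
  by move/(can_inj gK)=> E; apply: n21.
have /starP[_ [x' xx' u1]] := R1x.
have x'y : x' != y.
  apply/eqP=> E; apply: n10; subst; exact: adj_discrete_eq xy u1 u0.
have R2x' : R2 \in star x'.
  case: (adj_star SR1 SR2 a12 xx' u1) => // R2x; case: n20.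
  exact: adj_discrete_eq xy (star_together xy R2x R2y) u0.
have yx' : y != x' by rewrite eq_sym.
have := triangle_marked SR0 SR1 SR2 xy yx' xx' u0 u1 (star_together yx' R2y R2x').
rewrite -fS -(gK R1) -(gK R2) => /(marked_iso _ _ _ _ fK gK f_adj).
case/(star_not_marked Q0b Q1b Q2b).
- by move=> E; apply: n10; rewrite -E gK.
- by move=> E; apply: n20; rewrite -E gK.
- by move/(can_inj gK).
Qed.

(** Two edges at [a] have adjacent images, which share a vertex [x]; [star_char] then carries the
    whole star over. A star with one edge is treated separately. *)
Lemma star_image a b : coadj a b -> exists x, star x = f @: star a.
Proof.
move=> /star_nonempty[Q0 Q0a].
have [/existsP[Q1 /andP[Q1a /eqP n10]]|] :=
  boolP [exists Q, (Q \in star a) && (Q != Q0)]; last first.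
  rewrite negb_exists => /forallP H.
  have E : star a = [set Q0].
    apply/setP=> Q; rewrite inE; have [->//|nQ] := eqVneq Q Q0; apply/negbTE.
    by have := H Q; rewrite nQ andbT.
  by have [x xE] := star_single_image E; exists x; rewrite xE E imset_set1.
have SQ0 : adj S1 Q0 by case/starP: Q0a.
have SQ1 : adj S1 Q1 by case/starP: Q1a.
have SR0 : adj S2 (f Q0) by rewrite adj_fS.
have SR1 : adj S2 (f Q1) by rewrite adj_fS.
have a01 : adj Q0 Q1 by apply: star_adj Q0a Q1a _ => E; apply: n10.
have [x R0x R1x] : exists2 x, f Q0 \in star x & f Q1 \in star x.
  have [x [y [xy u0]]] := adj_discrete_ex SR0.
  have [R0x R0y] := star_edge SR0 xy u0.
  by have [] := adj_star SR0 SR1 _ xy u0; rewrite ?f_adj //; [exists x|exists y].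
have nf10 : f Q1 <> f Q0 by move/(can_inj fK).
exists x; apply/setP=> R; rewrite -(gK R) mem_imset; last exact: can_inj fK.
apply/idP/idP => [/(star_char _ R0x R1x nf10)|/(star_char _ Q0a Q1a n10)] H.
  apply/(star_char _ Q0a Q1a n10); case: H => [/(can_inj fK)->|[/(can_inj fK)->|]].
  - by left.
  - by right; left.
  rewrite -fS !f_adj => -[? ? ? nm]; right; right; split=> //.
  by move/(marked_iso _ _ _ _ fK gK f_adj).
apply/(star_char _ R0x R1x nf10); case: H => [->|[->|]].
- by left.
- by right; left.
move=> [? ? ? nm]; right; right; split; rewrite -?fS ?f_adj //.
by move/(marked_iso _ _ _ _ fK gK f_adj).
Qed.

(** A nonempty star shared by two vertices consists of an isolated edge of H, and its image is again
    isolated, so both ends have the same star. *)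
Lemma star_twin_image a b x : a != b -> star a = star b ->
  star x = f @: star a -> star a != set0 ->
  exists2 y, y != x & star y = star x.
Proof.
move=> ab sab xE /set0Pn[Q0 Q0a].
have Q0b : Q0 \in star b by rewrite -sab.
have SQ0 : adj S1 Q0 by case/starP: Q0a.
have t0 := star_together ab Q0a Q0b.
have a1 : star a = [set Q0].
  apply/setP=> Q; rewrite inE; apply/idP/eqP=> [Qa|->//].
  have Qb : Q \in star b by rewrite -sab.
  have SQ : adj S1 Q by case/starP: Qa.
  exact: adj_discrete_eq ab (star_together ab Qa Qb) t0.
have xE1 : star x = [set f Q0] by rewrite xE a1 imset_set1.
have /starP[SR0 [y xy u0]] : f Q0 \in star x by rewrite xE1 inE.
have [_ R0y] := star_edge SR0 xy u0.
exists y; first by rewrite eq_sym.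
rewrite xE1; apply/setP=> R; rewrite inE; apply/idP/eqP=> [Ry|->//].
have [//|/eqP nR] := eqVneq R (f Q0); exfalso.
have SR : adj S2 R by case/starP: Ry.
have aR : adj (f Q0) R by apply: star_adj R0y Ry _ => E; apply: nR.
have : g R \in star a.
  by case: (preim_adj_star SQ0 ab t0 SR aR); rewrite -?sab.
by rewrite a1 inE => /eqP E; apply: nR; rewrite -(gK R) E.
Qed.

End Stars.

(** An element is sent to the one of the same rank in the enumeration of the corresponding fibre. *)
Lemma fibre_injection (T1 T2 : finType) (U : eqType) (s1 : T1 -> U) (s2 : T2 -> U) :
  (forall u, #|[set a | s1 a == u]| <= #|[set x | s2 x == u]|) ->
  exists2 h : T1 -> T2, injective h & forall a, s2 (h a) = s1 a.
Proof.
move=> le.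
have rank a : index a (enum [set b | s1 b == s1 a]) < #|[set x | s2 x == s1 a]|.
  by apply: leq_trans (le _); rewrite cardE index_mem mem_enum inE.
have : forall a, exists x, (s2 x == s1 a) &&
    (index x (enum [set y | s2 y == s1 a]) == index a (enum [set b | s1 b == s1 a])).
  move=> a; have /card_gt0P[x0 _] : 0 < #|[set x | s2 x == s1 a]|.
    exact: leq_ltn_trans (rank a).
  pose x := nth x0 (enum [set x | s2 x == s1 a]) (index a (enum [set b | s1 b == s1 a])).
  exists x; rewrite index_uniq ?enum_uniq -?cardE // eqxx andbT.
  have : x \in enum [set x | s2 x == s1 a] by rewrite mem_nth -?cardE.
  by rewrite mem_enum inE.
move=> /fin_all_exists[h hP]; exists h => [a b E|a]; last first.
  by have /andP[/eqP] := hP a.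
have /andP[/eqP sa /eqP ia] := hP a; have /andP[/eqP sb /eqP ib] := hP b.
have sab : s1 a = s1 b by rewrite -sa E sb.
have := ia; rewrite E sab ib => /esym E'.
by apply: (index_inj a _ _ E'); rewrite mem_enum inE ?sab.
Qed.

(** * Moving the image of S to S *)

Section Descent.
Variable G : sgraph.
Local Notation B := (bell_graph G).
Local Notation S := (discrete G).
Implicit Types (P Q : B) (x y z u v w : G).

Definition weight P := #|[set p : G * G | together P p.1 p.2]|.

(** Any nontrivial part [A] of P satisfies the hypotheses of [toggle], by the lemmas on good
    partitions. Toggling splits [A], so fewer pairs are together. *)
Lemma good_toggle P : good P -> P <> S ->
  exists t : B -> B, [/\ involutive t, {mono t : Q R / adj Q R} &
    weight (t P) < weight P].
Proof.
move=> gP nS.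
have [/existsP[u /existsP[v /andP[uv Puv]]]|] :=
  boolP [exists u, exists v, (u != v) && together P u v]; last first.
  rewrite negb_exists => /forallP H; case: nS; apply: together_ext => x y.
  rewrite discreteE; have [<-|xy] := eqVneq x y; first exact: together_refl.
  have := H x; rewrite negb_exists => /forallP/(_ y).
  by rewrite xy => /negbTE.
pose A := [set x | together P u x].
have AE x y : x \in A -> together P x y = (y \in A).
  rewrite !inE => ux; apply/idP/idP => [|uy]; first exact: together_trans.
  by apply: together_trans uy; rewrite together_sym.
have uA : u \in A by rewrite inE together_refl.
have vA : v \in A by rewrite inE.
have cA : clique A by move=> x y xA yA; apply: (@together_nadj _ P); rewrite AE.
have A_gt1 : 1 < #|A|.
  by apply: (@uniq_card _ A [:: u; v]); rewrite /= ?inE ?uv // together_refl Puv.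
have tA x y : x \in A -> y \in A -> together P x y by move=> xA; rewrite AE.
have seq_card (s : seq G) : {subset A <= s} -> #|A| <= size s.
  by move=> sA; apply: leq_trans (card_size s); apply/subset_leq_card/subsetP.
have A_le3 : #|A| <= 3.
  have [/existsP[w /and3P[wA wu wv]]|] :=
    boolP [exists w, [&& w \in A, w != u & w != v]].
    apply: (seq_card [:: u; v; w]) => t ta; rewrite !inE.
    have [//|tu] := eqVneq t u; have [//|tv] := eqVneq t v; apply: contraT => tw.
    have Put : together P u t = false.
      by apply: (good_card_part gP Puv (tA _ _ uA wA) uv); neq_side.
    by rewrite tA in Put.
  rewrite negb_exists => /forallP H; apply: leq_trans (seq_card [:: u; v] _) _ => //.
  by move=> t ta; have := H t; rewrite ta !inE -negb_or negbK.
have leafA x z : x \in A -> z \notin A -> coadj x z ->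
    #|A| = 2 /\ forall y, coadj z y -> y = x.
  move=> xA zA xz; have [y yA] := other A_gt1 x; rewrite eq_sym => xy.
  have nxz : ~~ together P x z by rewrite AE.
  split=> [|t zt].
    apply/eqP; rewrite eqn_leq A_gt1 andbT; apply: (seq_card [:: x; y]) => t ta.
    rewrite !inE; have [//|tx] := eqVneq t x; apply: contraTT xz => ty.
    by apply: (good_part3 gP (tA _ _ xA yA) (tA _ _ xA ta) xy); neq_side.
  apply/eqP; apply: contraTT zt => tx.
  exact: (good_part2_leaf gP (tA _ _ xA yA) xy nxz xz tx).
exists (toggle cA); split; [exact: toggleK|exact: toggle_adj|].
rewrite /toggle ifT; last by apply/is_partP=> x y; apply: AE.
apply/proper_card/properP; split.
  apply/subsetP=> -[x y]; rewrite !inE dissolveE /=; case: ifP => // _ /eqP->.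
  exact: together_refl.
by exists (u, v); rewrite !inE /= // dissolveE uA /= (negbTE uv).
Qed.

End Descent.

(** The image of S is good because S is. Composing with toggles lowers its weight until it is S. *)
Lemma iso_discrete (G1 G2 : sgraph) (f : bell_graph G1 -> bell_graph G2) g :
  cancel f g -> cancel g f -> {mono f : x y / adj x y} ->
  exists (f' : bell_graph G1 -> bell_graph G2) g',
    [/\ cancel f' g', cancel g' f', {mono f' : x y / adj x y} &
        f' (discrete G1) = discrete G2].
Proof.
have [n] := ubnP (weight (f (discrete G1))).
elim: n f g => // n IHn f g le_n fK gK fa.
have [E|/eqP nE] := eqVneq (f (discrete G1)) (discrete G2); first by exists f, g.
have [t [tK ta lt]] := good_toggle (good_iso fK gK fa (@discrete_good G1)) nE.
apply: (IHn (t \o f) (g \o t)) => [|||P Q].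
- exact: leq_trans lt le_n.
- exact: can_comp.
- exact: can_comp.
- exact: etrans (ta _ _) (fa _ _).
Qed.

(** * Recovering the graph without universal vertices *)

Section Universal.
Variable G : sgraph.
Implicit Types v w : G.

(** The degrees of [v] in G and in H add up to |V(G)| - 1, so universal means isolated in H. *)
Lemma nonuniversalP v : reflect (exists w, coadj v w) (~~ universal v).
Proof.
have E : [set w | coadj v w] = ~: (v |: [set w | adj v w]).
  by apply/setP=> w; rewrite !inE /coadj negb_or eq_sym.
have C := cardsC (v |: [set w | adj v w]).
rewrite cardsU1 inE adj_irrefl -E add1n addSn in C.
have -> : ~~ universal v = (0 < #|[set w | coadj v w]|).
  rewrite /universal /degree -C /=.
  by rewrite -[X in X == _]addn0 eqn_add2l eq_sym lt0n.
by apply: (iffP card_gt0P) => -[w]; rewrite ?inE => H; exists w; rewrite ?inE.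
Qed.

Lemma universal_single v (P : bell_graph G) w :
  universal v -> together P v w = (v == w).
Proof.
move=> uv; have [<-|vw] := eqVneq v w; first exact: together_refl.
apply: contraTF uv => t; apply/nonuniversalP; exists w.
exact: together_coadj t.
Qed.

End Universal.

(** A common element of the two stars is the edge ab itself; thus the stars determine H. *)
Lemma coadj_star (G : sgraph) (a b : G) : a != b ->
  coadj a b = (star a :&: star b != set0).
Proof.
move=> ab; apply/idP/set0Pn=> [H|[Q /setIP[Qa Qb]]].
  have [Q SQ t] := discrete_edge H; exists Q; apply/setIP.
  exact: star_edge SQ ab t.
exact: together_coadj ab (star_together ab Qa Qb).
Qed.

(** Vertices are matched through their stars, with multiplicity, since the ends of an isolated edge
    of H have the same star. *)
Lemma star_injection (G1 G2 : sgraph) (f : bell_graph G1 -> bell_graph G2) g :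
  cancel f g -> cancel g f -> {mono f : x y / adj x y} ->
  f (discrete G1) = discrete G2 ->
  exists2 h : remove_universal G1 -> remove_universal G2, injective h &
    forall a, star (val (h a)) = f @: star (val a).
Proof.
move=> fK gK fa fS.
apply: (@fibre_injection _ _ _ (fun a => f @: star (val a)) (fun x => star (val x))) => F.
have [->|[a0]] := set_0Vmem [set a : remove_universal G1 | f @: star (val a) == F].
  by rewrite cards0.
rewrite inE => /eqP <- {F}.
have [b0 ab0] := nonuniversalP _ (valP a0).
have [x xE] := star_image fK gK fa fS ab0.
have [Q0 Q0a] := star_nonempty ab0.
have nu z Q : Q \in star z -> ~~ universal z.
  case/starP=> _ [w zw t]; apply/nonuniversalP; exists w; exact: together_coadj t.
have fQ0x : f Q0 \in star x by rewrite xE imset_f.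
pose x' : remove_universal G2 := Sub x (nu _ x _ fQ0x).
have x'F : x' \in [set z : remove_universal G2 | star (val z) == f @: star (val a0)].
  by rewrite inE /= xE.
have sE a : f @: star (val a) == f @: star (val a0) -> star (val a) = star (val a0).
  by move=> /eqP /(imset_inj (can_inj fK)).
(* If [a0] alone has its star, [x'] suffices. Otherwise the star is an isolated edge, and its image
   provides a second vertex [y']. *)
have [/existsP[a1 /andP[a10 /sE s1]]|] :=
  boolP [exists a : remove_universal G1, (a != a0) && (f @: star (val a) == f @: star (val a0))];
  last first.
  rewrite negb_exists => /forallP H; apply: (@leq_trans #|[set x']|); last first.
    by apply/subset_leq_card; rewrite sub1set.
  rewrite cards1 -(cards1 a0); apply/subset_leq_card/subsetP=> a; rewrite !inE.
  by have := H a; case: eqVneq => //= _ /negbTE ->.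
have a01 : val a0 != val a1 by rewrite eq_sym (inj_eq val_inj).
have [y yx yE] : exists2 y, y != x & star y = star x.
  apply: (star_twin_image gK fa fS a01 (esym s1) xE).
  by apply/set0Pn; exists Q0.
have fQ0y : f Q0 \in star y by rewrite yE.
pose y' : remove_universal G2 := Sub y (nu _ y _ fQ0y).
(* No third vertex has this star, because Q0 has only the ends [a0] and [a1]. *)
apply: (@leq_trans #|[set a0; a1]|).
  apply/subset_leq_card/subsetP=> a; rewrite !inE => /sE sa.
  have Q0a' : Q0 \in star (val a) by rewrite sa.
  have Q0a1 : Q0 \in star (val a1) by rewrite s1.
  have SQ0 : adj (discrete G1) Q0 by case/starP: Q0a.
  apply: contraT; rewrite negb_or => /andP[na0 na1].
  have := star_together _ Q0a Q0a'; rewrite eq_sym (inj_eq val_inj) => /(_ na0).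
  rewrite (adj_discreteE SQ0 a01 (star_together a01 Q0a Q0a1)) !inE eqxx.
  by rewrite !(inj_eq val_inj) [a0 == a]eq_sym (negbTE na0) (negbTE na1).
rewrite cards2 eq_sym a10; apply: (@leq_trans #|[set x'; y']|).
  by rewrite cards2 -(inj_eq val_inj) /= eq_sym yx.
apply/subset_leq_card/subsetP=> z; rewrite !inE => /orP[]/eqP->/=.
  by rewrite xE.
by rewrite yE xE.
Qed.

Lemma isomorphic_of_bell (G1 G2 : sgraph) :
  isomorphic (bell_graph G1) (bell_graph G2) ->
  isomorphic (remove_universal G1) (remove_universal G2).
Proof.
case=> f0 [[g0 f0K g0K] f0a].
have [f [g [fK gK fa fS]]] := iso_discrete f0K g0K f0a.
have gS : g (discrete G2) = discrete G1 by rewrite -fS fK.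
have [h hI hE] := star_injection fK gK fa fS.
have [k kI _] := star_injection gK fK (inv_adj gK fa) gS.
(* The injection [k] in the other direction bounds the cardinality, making [h] bijective. *)
exists h; split; first exact: inj_card_bij hI (leq_card k kI).
move=> a b; have [->|ab] := eqVneq a b; first by rewrite !adj_irrefl.
have vab : val a != val b by rewrite (inj_eq val_inj).
have hab : val (h a) != val (h b) by rewrite (inj_eq val_inj) (inj_eq hI).
(* For distinct vertices nonadjacency is adjacency in H, that is, intersecting stars, and the
   injective [f] commutes with intersections. *)
apply: negb_inj.
have := coadj_star vab; have := coadj_star hab; rewrite /coadj hab vab !hE /=.
move=> -> ->; rewrite -imsetI; last by move=> P Q _ _ /(can_inj fK).
by rewrite imset_eq0.
Qed.

(** * Pulling partitions back along a map of reduced graphs *)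

Section Lift.
Variables (G1 G2 : sgraph) (h : remove_universal G2 -> remove_universal G1).
Hypothesis h_adj : forall x y, adj x y -> adj (h x) (h y).

(** A universal vertex of G2, where [insub] fails, gets a colour of its own; any other takes the
    part of its image under [h]. *)
Definition lift_colour (P : bell_graph G1) (x : G2) : {set G1} + G2 :=
  if insub x is Some x' then inl (pblock (val P) (val (h x'))) else inr x.

Lemma lift_subproof P x y : adj x y -> lift_colour P x != lift_colour P y.
Proof.
move=> xy; rewrite /lift_colour.
case: insubP => [x' _ x'E|_]; case: insubP => [y' _ y'E|_] //.
  apply/eqP=> -[]/eqP/together_nadj/negP[].
  by apply: (@h_adj x' y'); rewrite /adj /= /induced_adj x'E y'E.
by apply/eqP=> -[] E; rewrite E adj_irrefl in xy.
Qed.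

Definition lift (P : bell_graph G1) : bell_graph G2 :=
  of_colouring (@lift_subproof P).

Lemma lift_val P (x y : remove_universal G2) :
  together (lift P) (val x) (val y) = together P (val (h x)) (val (h y)).
Proof. by rewrite together_colouring /lift_colour !valK. Qed.

Lemma near_lift (v : remove_universal G2) P Q : injective h ->
  near (val (h v)) P Q -> near (val v) (lift P) (lift Q).
Proof.
move=> hI n x y xv yv; rewrite !together_colouring /lift_colour.
case: insubP => [x' _ x'E|_]; case: insubP => [y' _ y'E|_] //.
by apply: n; rewrite (inj_eq val_inj) (inj_eq hI) -(inj_eq val_inj) ?x'E ?y'E.
Qed.

End Lift.

(** Universal vertices are single in every partition, so only the others need comparison. *)
Lemma liftK (G1 G2 : sgraph) (h : remove_universal G2 -> remove_universal G1) k
    (hP : forall x y, adj x y -> adj (h x) (h y))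
    (kP : forall x y, adj x y -> adj (k x) (k y)) :
  cancel k h -> cancel (lift hP) (lift kP).
Proof.
move=> kK P; apply: together_ext => x y.
have [ux|nx] := boolP (universal x); first by rewrite !universal_single.
have [uy|ny] := boolP (universal y).
  by rewrite together_sym [RHS]together_sym !universal_single.
pose x' : remove_universal G1 := Sub x nx.
pose y' : remove_universal G1 := Sub y ny.
by have := lift_val kP (lift hP P) x' y'; rewrite [RHS]lift_val !kK.
Qed.

Lemma lift_adj (G1 G2 : sgraph) (h : remove_universal G2 -> remove_universal G1) k
    (hP : forall x y, adj x y -> adj (h x) (h y)) P Q :
  cancel k h -> cancel h k -> injective (lift hP) -> adj P Q ->
  adj (lift hP P) (lift hP Q).
Proof.
move=> kK hK lI /bell_adjP[PQ [v n]]; apply/bell_adjP; split; first by move/lI.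
(* A universal [v] is single in both partitions, so agreement off [v] would give [P = Q]. *)
have [uv|nv] := boolP (universal v).
  case: PQ; apply: together_ext => x y.
  have [->|xv] := eqVneq x v; first by rewrite !universal_single.
  have [->|yv] := eqVneq y v; last exact: n.
  by rewrite [LHS]together_sym [RHS]together_sym !universal_single.
exists (val (k (Sub v nv))); apply: near_lift; first exact: can_inj hK.
by rewrite kK SubK.
Qed.

Lemma bell_of_isomorphic (G1 G2 : sgraph) :
  isomorphic (remove_universal G1) (remove_universal G2) ->
  isomorphic (bell_graph G1) (bell_graph G2).
Proof.
case=> f [[g fK gK] fa].
have fP x y : adj x y -> adj (f x) (f y) by rewrite fa.
have gP x y : adj x y -> adj (g x) (g y) by rewrite -fa !gK.
have lK := liftK gP fP fK; have lK' := liftK fP gP gK.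
(* Lifting is contravariant, so the inverse [g] yields the map from partitions of G1 to those of
   G2. *)
exists (lift gP); split; first by exists (lift fP).
move=> P Q; apply/idP/idP; last exact: (lift_adj fK gK (can_inj lK)).
by rewrite -{2}(lK P) -{2}(lK Q); apply: (lift_adj gK fK (can_inj lK')).
Qed.

Theorem theorem1p4 (G1 G2 : sgraph) :
  isomorphic (bell_graph G1) (bell_graph G2) <->
  isomorphic (remove_universal G1) (remove_universal G2).
Proof. by split; [apply: isomorphic_of_bell|apply: bell_of_isomorphic]. Qed.
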